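(* Let $p$ be a prime, $k$ a perfect field of characteristic $p$, $K$ a complete discretely valued extension of $\mathbb Q_p$ with ring of integers $\mathcal O_K$, residue field $k$ and ramification degree $e$, and let $r\ge0$ be an integer with $er<p-1$. Then $\mathrm{ModFI}^{r,\varphi}_{/\mathfrak S_\infty}=\mathrm{Mod}^{r,\varphi}_{/\mathfrak S_\infty}$; that is, every object of $\mathrm{Mod}^{r,\varphi}_{/\mathfrak S_\infty}$ is isomorphic as an $\mathfrak S$-module to $\bigoplus_{i=1}^n\mathfrak S/p^{a_i}$ for some integers $a_i$.
   Context: $\mathfrak S=W(k)[[u]]$ with Frobenius $\varphi$ (Frobenius on $W(k)$, $u\mapsto u^p$); $E\in\mathfrak S$ is the Eisenstein polynomial of a fixed uniformizer of $\mathcal O_K$. The category $'\mathrm{Mod}^{r,\varphi}_{/\mathfrak S}$ has objects $\mathfrak S$-modules $\mathfrak M$ with a $\varphi$-semilinear endomorphism $\varphi:\mathfrak M\to\mathfrak M$ such that the cokernel of the linearization $\mathfrak S\otimes_{\varphi,\mathfrak S}\mathfrak M\to\mathfrak M$ is killed by $E^r$; morphisms are $\mathfrak S$-linear maps commuting with $\varphi$; a short sequence is exact if exact as $\mathfrak S$-modules. $\mathrm{Mod}^{r,\varphi}_{/\mathfrak S_1}$ is the full subcategory of objects finite free over $\mathfrak S/p=k[[u]]$. $\mathrm{Mod}^{r,\varphi}_{/\mathfrak S_\infty}$ is the smallest full subcategory of $'\mathrm{Mod}^{r,\varphi}_{/\mathfrak S}$ containing $\mathrm{Mod}^{r,\varphi}_{/\mathfrak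 S_1}$ and stable under extensions. $\mathrm{ModFI}^{r,\varphi}_{/\mathfrak S_\infty}$ is its full subcategory of objects isomorphic as $\mathfrak S$-modules to some $\bigoplus_{i=1}^n\mathfrak S/p^{a_i}$. *)

(* Defs.v *)
From HB Require Import structures.
From mathcomp Require Import all_boot all_order all_algebra.
From mathcomp Require Import ring_quotient generic_quotient.
From mathcomp Require Import boolp.

Set Implicit Arguments.
Unset Strict Implicit.
Unset Printing Implicit Defensive.

Import Order.TTheory GRing.Theory Num.Theory.
Local Open Scope ring_scope.

(** * Formal power series R[[u]] *)

(* A series is its sequence of coefficients.  The alias keeps the Cauchy
   product apart from the pointwise product on functions. *)
Definition fps (R : Type) : Type := nat -> R.

Section PowerSeries.
Variable R : comNzRingType.
Implicit Types f g h : fps R.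

Definition fps_zero : fps R := fun=> 0.
Definition fps_opp f : fps R := fun n => - f n.
Definition fps_add f g : fps R := fun n => f n + g n.
Definition fps_one : fps R := fun n => (n == 0%N)%:R.
Definition fps_mul f g : fps R := fun n => \sum_(i < n.+1) f i * g (n - i)%N.

HB.instance Definition _ := gen_eqMixin (fps R).
HB.instance Definition _ := gen_choiceMixin (fps R).

Fact fps_addA : associative fps_add.
Proof. by move=> f g h; apply/funext => n; rewrite /fps_add addrA. Qed.
Fact fps_addC : commutative fps_add.
Proof. by move=> f g; apply/funext => n; rewrite /fps_add addrC. Qed.
Fact fps_add0 : left_id fps_zero fps_add.
Proof. by move=> f; apply/funext => n; rewrite /fps_add add0r. Qed.
Fact fps_addN : left_inverse fps_zero fps_opp fps_add.
Proof. by move=> f; apply/funext => n; rewrite /fps_add addNr. Qed.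

HB.instance Definition _ :=
  GRing.isZmodule.Build (fps R) fps_addA fps_addC fps_add0 fps_addN.

Let tr N f : {poly R} := \poly_(i < N.+1) f i.

Let mulE N f g n : (n <= N)%N -> fps_mul f g n = (tr N f * tr N g)`_n.
Proof.
move=> nN; rewrite coefM; apply: eq_bigr => i _; rewrite !coef_poly !ltnS.
by rewrite (leq_trans (leq_subr _ _) nN) (leq_trans _ nN) // -ltnS ltn_ord.
Qed.

Let coefM_eq (a a' b b' : {poly R}) n :
  (forall i, (i <= n)%N -> a`_i = a'`_i) ->
  (forall i, (i <= n)%N -> b`_i = b'`_i) -> (a * b)`_n = (a' * b')`_n.
Proof.
move=> aa bb; rewrite !coefM; apply: eq_bigr => i _.
by rewrite aa ?bb ?leq_subr // -ltnS ltn_ord.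
Qed.

Let trM f g n i : (i <= n)%N -> (tr n (fps_mul f g))`_i = (tr n f * tr n g)`_i.
Proof. by move=> le_in; rewrite coef_poly ltnS le_in (mulE _ _ le_in). Qed.

Fact fps_mulA : associative fps_mul.
Proof.
move=> f g h; apply/funext => n; rewrite !(mulE _ _ (leqnn n)).
rewrite (@coefM_eq _ (tr n f) _ (tr n g * tr n h)) //; last first.
  by move=> i le_in; rewrite trM.
rewrite mulrA; apply: coefM_eq => // i le_in.
by rewrite trM.
Qed.

Fact fps_mulC : commutative fps_mul.
Proof. by move=> f g; apply/funext => n; rewrite !(mulE _ _ (leqnn n)) mulrC. Qed.

Fact fps_mul1 : left_id fps_one fps_mul.
Proof.
move=> f; apply/funext => n; rewrite /fps_mul big_ord_recl /= subn0 mul1r.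
by rewrite big1 ?addr0 // => i _; rewrite /fps_one /= mul0r.
Qed.

Fact fps_mulDl : left_distributive fps_mul +%R.
Proof.
move=> f g h; apply/funext => n; rewrite [RHS]/GRing.add /= /fps_add /fps_mul.
by rewrite -big_split; apply: eq_bigr => i _; exact: mulrDl.
Qed.

Fact fps_one_neq0 : fps_one != 0.
Proof.
by apply/eqP => /(congr1 (fun f => f 0%N)) /eqP; rewrite /= oner_eq0.
Qed.

HB.instance Definition _ := GRing.Zmodule_isComNzRing.Build (fps R)
  fps_mulA fps_mulC fps_mul1 fps_mulDl fps_one_neq0.

Definition fps_of_poly (P : {poly R}) : fps R := fun n => P`_n.

End PowerSeries.

(* \sum a_n u^n |-> \sum sigma(a_n) u^(p n) *)
Definition fps_frob (p : nat) (W : comNzRingType) (sigma : W -> W)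
    (f : fps W) : fps W :=
  fun n => if (p %| n)%N then sigma (f (n %/ p)%N) else 0.

Definition divides (R : comNzRingType) (a x : R) : Prop := exists y, x = a * y.

(** * The module R/(c) and finite direct sums *)

Section CyclicModule.
Variables (R : comNzRingType) (c : R).

Definition princ : {pred R} := fun x => `[< divides c x >].

Fact princ_zmod_closed : zmod_closed princ.
Proof.
split=> [|x y /asboolP[x' ->] /asboolP[y' ->]]; apply/asboolP.
  by exists 0; rewrite mulr0.
by exists (x' - y'); rewrite mulrBr.
Qed.
HB.instance Definition _ := GRing.isZmodClosed.Build R princ princ_zmod_closed.

Definition cycmod : Type := (Quotient.quot princ).
HB.instance Definition _ := GRing.Zmodule.on cycmod.

Local Notation proj := (\pi_((Quotient.quot princ))%qT).

Definition cyc_scale (a : R) (x : cycmod) : cycmod := proj (a * repr x).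

Let projZ a x : cyc_scale a (proj x) = proj (a * x).
Proof.
apply/eqP; rewrite /cyc_scale -Quotient.idealrBE -mulrBr.
have : repr (proj x) - x \in princ by rewrite Quotient.idealrBE reprK.
by move=> /asboolP[y ->]; apply/asboolP; exists (a * y); rewrite mulrCA.
Qed.

Let projD x y : proj (x + y) = proj x + proj y.
Proof. exact: raddfD. Qed.

Fact cyc_scaleA a b x : cyc_scale a (cyc_scale b x) = cyc_scale (a * b) x.
Proof. by rewrite -[x](@reprK _ (Quotient.quot princ)) !projZ mulrA. Qed.
Fact cyc_scale1 : left_id 1 cyc_scale.
Proof. by move=> x; rewrite -[x](@reprK _ (Quotient.quot princ)) projZ mul1r. Qed.
Fact cyc_scaleDr : right_distributive cyc_scale +%R.
Proof.
move=> a x y; rewrite -[x](@reprK _ (Quotient.quot princ)) -[y](@reprK _ (Quotient.quot princ)).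
by rewrite -projD !projZ mulrDr projD.
Qed.
Fact cyc_scaleDl x : {morph cyc_scale^~ x : a b / a + b}.
Proof.
by move=> a b; rewrite -[x](@reprK _ (Quotient.quot princ)) !projZ mulrDl projD.
Qed.

HB.instance Definition _ := GRing.Zmodule_isLmodule.Build R cycmod
  cyc_scaleA cyc_scale1 cyc_scaleDr cyc_scaleDl.

End CyclicModule.

Definition dsum (R : pzRingType) (n : nat) (V : 'I_n -> lmodType R) : Type :=
  forall i, V i.

Section DirectSum.
Variables (R : pzRingType) (n : nat) (V : 'I_n -> lmodType R).
Implicit Types x y : dsum V.

HB.instance Definition _ := gen_eqMixin (dsum V).
HB.instance Definition _ := gen_choiceMixin (dsum V).

Definition dsum_zero : dsum V := fun=> 0.
Definition dsum_opp x : dsum V := fun i => - x i.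
Definition dsum_add x y : dsum V := fun i => x i + y i.
Definition dsum_scale (a : R) x : dsum V := fun i => a *: x i.

Fact dsum_addA : associative dsum_add.
Proof. by move=> x y z; apply: functional_extensionality_dep => i; exact: addrA. Qed.
Fact dsum_addC : commutative dsum_add.
Proof. by move=> x y; apply: functional_extensionality_dep => i; exact: addrC. Qed.
Fact dsum_add0 : left_id dsum_zero dsum_add.
Proof. by move=> x; apply: functional_extensionality_dep => i; exact: add0r. Qed.
Fact dsum_addN : left_inverse dsum_zero dsum_opp dsum_add.
Proof. by move=> x; apply: functional_extensionality_dep => i; exact: addNr. Qed.

HB.instance Definition _ :=
  GRing.isZmodule.Build (dsum V) dsum_addA dsum_addC dsum_add0 dsum_addN.

Fact dsum_scaleA a b x : dsum_scale a (dsum_scale b x) = dsum_scale (a * b) x.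
Proof. by apply: functional_extensionality_dep => i; exact: scalerA. Qed.
Fact dsum_scale1 : left_id 1 dsum_scale.
Proof. by move=> x; apply: functional_extensionality_dep => i; exact: scale1r. Qed.
Fact dsum_scaleDr : right_distributive dsum_scale +%R.
Proof. by move=> a x y; apply: functional_extensionality_dep => i; exact: scalerDr. Qed.
Fact dsum_scaleDl x : {morph dsum_scale^~ x : a b / a + b}.
Proof. by move=> a b; apply: functional_extensionality_dep => i; exact: scalerDl. Qed.

HB.instance Definition _ := GRing.Zmodule_isLmodule.Build R (dsum V)
  dsum_scaleA dsum_scale1 dsum_scaleDr dsum_scaleDl.

End DirectSum.

Definition lmod_isom (R : pzRingType) (U V : lmodType R) : Prop :=
  exists f : {linear U -> V}, bijective f.

(** * Witt vectors of a perfect field *)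

Definition perfect_field (p : nat) (k : fieldType) : Prop :=
  p \in [pchar k] /\ forall x : k, exists y, y ^+ p = x.

(* W(k) is determined, up to unique isomorphism over k, as the strict p-ring
   with residue field k: a p-torsion free, p-adically separated and complete
   ring with W/pW = k.  [res] is the projection to W/pW. *)
Record is_witt_ring (p : nat) (k : fieldType) (W : comNzRingType)
    (res : {rmorphism W -> k}) : Prop := IsWittRing {
  witt_res_surj : forall a : k, exists x, res x = a;
  witt_res_ker : forall x, res x = 0 <-> divides p%:R x;
  witt_torsionfree : forall x : W, p%:R * x = 0 -> x = 0;
  witt_separated : forall x : W, (forall n, divides (p%:R ^+ n) x) -> x = 0;
  witt_complete : forall x : nat -> W,
    (forall n, divides (p%:R ^+ n) (x n.+1 - x n)) ->
    exists l, forall n, divides (p%:R ^+ n) (x n - l)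
}.

(* For k perfect, the Frobenius of W(k) is the unique endomorphism lifting
   x |-> x^p on W/pW. *)
Definition is_witt_frobenius (p : nat) (W : comNzRingType)
    (sigma : {rmorphism W -> W}) : Prop :=
  forall x, divides p%:R (sigma x - x ^+ p).

(** * Discretely valued fields *)

(* Normalized discrete valuations; the value at 0 is irrelevant. *)
Record discreteValuation (K : fieldType) := DiscreteValuation {
  dval :> K -> int;
  dvalM : forall x y, x != 0 -> y != 0 -> dval (x * y) = dval x + dval y;
  dvalD : forall x y, x != 0 -> y != 0 -> x + y != 0 ->
    Num.min (dval x) (dval y) <= dval (x + y);
  dval_normalized : exists2 x, x != 0 & dval x = 1
}.

(* v x >= N, with the convention v 0 = +oo *)
Definition dval_ge (K : fieldType) (v : discreteValuation K) (N : int) :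
  {pred K} := fun x => (x == 0) || (N <= v x).

Definition dval_complete (K : fieldType) (v : discreteValuation K) : Prop :=
  forall x : nat -> K,
    (forall N : int, exists n0, forall m n, (n0 <= m)%N -> (n0 <= n)%N ->
       x m - x n \in dval_ge v N) ->
    exists l, forall N : int, exists n0, forall n, (n0 <= n)%N ->
       x n - l \in dval_ge v N.

Section RingOfIntegers.
Variables (K : fieldType) (v : discreteValuation K).

Let v1 : v 1 = 0.
Proof.
have := dvalM v (oner_neq0 K) (oner_neq0 K); rewrite mulr1 => /eqP.
by rewrite -subr_eq0 opprD addrA subrr add0r oppr_eq0 => /eqP.
Qed.

Let vN x : x != 0 -> v (- x) = v x.
Proof.
have n1 : - (1 : K) != 0 by rewrite oppr_eq0 oner_neq0.
have vN1 : v (-1) = 0.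
  have := dvalM v n1 n1; rewrite mulrNN mulr1 v1 => /esym /eqP.
  by rewrite -mulr2n mulrn_eq0 /= => /eqP.
by move=> x0; rewrite -mulN1r dvalM // vN1 add0r.
Qed.

Fact dval_ge0_subring_closed : subring_closed (dval_ge v 0).
Proof.
split=> [|x y|x y]; rewrite !unfold_in ?v1 ?lexx ?orbT //.
- have [-> _|x0 /= vx] := eqVneq x 0.
    by rewrite sub0r oppr_eq0; have [//|y0 /=] := eqVneq y 0; rewrite vN.
  have [-> _|y0 /= vy] := eqVneq y 0; first by rewrite subr0 vx orbT.
  have [//|xy0 /=] := eqVneq (x - y) 0.
  have yn0 : - y != 0 by rewrite oppr_eq0.
  by apply: le_trans (dvalD v x0 yn0 xy0); rewrite le_min vx vN.
- have [-> _ _|x0 /= vx] := eqVneq x 0; first by rewrite mul0r eqxx.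
  have [-> _|y0 /= vy] := eqVneq y 0; first by rewrite mulr0 eqxx.
  by rewrite dvalM // addr_ge0 ?orbT.
Qed.

HB.instance Definition _ :=
  GRing.isSubringClosed.Build K (dval_ge v 0) dval_ge0_subring_closed.

Record valring := ValRing { valring_val :> K; _ : valring_val \in dval_ge v 0 }.

HB.instance Definition _ := [isSub for valring_val].
HB.instance Definition _ := [Choice of valring by <:].
HB.instance Definition _ := [SubChoice_isSubComNzRing of valring by <:].

End RingOfIntegers.

(* [res] identifies k with the quotient of O_K by its maximal ideal. *)
Definition is_residue_map (K : fieldType) (v : discreteValuation K)
    (k : fieldType) (res : {rmorphism valring v -> k}) : Prop :=
  (forall a : k, exists x, res x = a) /\
  (forall x, res x = 0 <-> valring_val x \in dval_ge v 1).

Definition is_uniformizer (K : fieldType) (v : discreteValuation K)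
    (pi : valring v) : Prop :=
  valring_val pi != 0 /\ v (valring_val pi) = 1.

Definition eisenstein (p : nat) (W : comNzRingType) (E : {poly W}) : Prop :=
  [/\ E \is monic, (1 < size E)%N,
      forall i, (i < (size E).-1)%N -> divides p%:R E`_i
    & ~ divides (p%:R ^+ 2) E`_0].

(* An Eisenstein polynomial over W is irreducible over Frac W, so E is the
   minimal polynomial of pi. *)
Definition eisenstein_poly_of (p : nat) (W O : comNzRingType)
    (iota : {rmorphism W -> O}) (pi : O) (E : {poly W}) : Prop :=
  eisenstein p E /\ root (map_poly iota E) pi.

(** * Torsion phi-modules over S = W[[u]] *)

Section PhiModules.
Variables (p : nat) (W : comNzRingType) (sigma : {rmorphism W -> W}).
Variables (E : {poly W}) (r : nat).

Local Notation S := (fps W).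

(* [phiMod_height]: the image of the linearization S (x)_phi M -> M,
   s (x) m |-> s phi(m), is the set of sums \sum_i s_i phi(m_i), and its
   cokernel is killed by E^r. *)
Record phiMod := PhiMod {
  phiMod_car :> lmodType S;
  phi : phiMod_car -> phiMod_car;
  phi_additive : {morph phi : x y / x + y};
  phi_semilinear : forall (s : S) x, phi (s *: x) = fps_frob p sigma s *: phi x;
  phiMod_height : forall x, exists (n : nat) (s : 'I_n -> S)
      (m : 'I_n -> phiMod_car),
    fps_of_poly E ^+ r *: x = \sum_i s i *: phi (m i)
}.

Definition phi_morphism (M N : phiMod) (f : {linear M -> N}) : Prop :=
  forall x, f (phi x) = phi (f x).

Definition short_exact (M' M M'' : phiMod)
    (f : {linear M' -> M}) (g : {linear M -> M''}) : Prop :=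
  [/\ phi_morphism f, phi_morphism g, injective f,
      (forall z, exists y, g y = z)
    & forall y, g y = 0 <-> exists x, f x = y].

(* \bigoplus_(i < n) S / p^(a i) *)
Definition torsion_sum (n : nat) (a : 'I_n -> nat) : lmodType S :=
  dsum (fun i => cycmod ((p%:R : S) ^+ a i) : lmodType S).

(* Finite free over S/p, i.e. isomorphic to some (S/p)^n. *)
Definition Mod1 (M : phiMod) : Prop :=
  exists n : nat, lmod_isom M (@torsion_sum n (fun=> 1%N)).

Inductive ModInf : phiMod -> Prop :=
| ModInf_base M : Mod1 M -> ModInf M
| ModInf_ext (M' M M'' : phiMod) (f : {linear M' -> M}) (g : {linear M -> M''}) :
    short_exact f g -> ModInf M' -> ModInf M'' -> ModInf M.

Definition ModFI (M : phiMod) : Prop :=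
  ModInf M /\ exists (n : nat) (a : 'I_n -> nat), lmod_isom M (torsion_sum a).

End PhiModules.

(* Main.v *)
Require Import Defs.
From HB Require Import structures.
From mathcomp Require Import all_boot all_order all_algebra.
From mathcomp Require Import ring_quotient generic_quotient.
From mathcomp Require Import boolp.
Set Implicit Arguments.
Unset Strict Implicit.
Unset Printing Implicit Defensive.
Import Order.TTheory GRing.Theory Num.Theory.
Local Open Scope ring_scope.

(** Let M be an object of Mod_(S_oo).  Up to powers of p, S is generated by
    1, u, ..., u^(p-1) over phi(S), so the linearization of phi is the map
    (m_0, ..., m_(p-1)) |-> \sum_j u^j phi(m_j).  It is injective: this is stable
    under extensions, and over k[[u]] the matrix of phi has nonzero determinant
    because that determinant divides a power of u.

    Each p^i M / p^(i+1) M is u-torsion free.  Let u^n kill its u-torsion and let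
    x represent a torsion class.  Then u^n phi(x) = p^(i+1) y for some y, and
    since E = u^e modulo p, the height condition on y gives
    u^(er+n) phi(x) = p^(i+1) \sum_j u^j phi(m_j).  Injectivity yields
    u^q x \in p^(i+1) M with q = (er + n) / p, and q < n as soon as n > 0,
    because er < p - 1.  Hence n can be taken to be 0.

    A basis of p^i M with cyclic spans S/p^a is then obtained by descending
    induction on i: divide the basis of p^(i+1) M by p, and complete it by a basis
    of the finite free k[[u]]-module N[p] / (N[p] \cap pN), with N = p^i M. *)

(** * Power series *)

Section PowerSeriesVariable.
Variable R : comNzRingType.
Implicit Types f g h : fps R.

Definition fps_var : fps R := fun n => (n == 1%N)%:R.

Lemma fps_addE f g n : (f + g) n = f n + g n. Proof. by []. Qed.

Lemma fps_oppE f n : (- f) n = - f n. Proof. by []. Qed.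

Lemma fps_sumE (I : Type) (s : seq I) (P : pred I) (F : I -> fps R) n :
  (\sum_(i <- s | P i) F i) n = \sum_(i <- s | P i) F i n.
Proof. exact: (big_morph (fun f : fps R => f n)). Qed.

Lemma fps_mulE f g n : (f * g) n = \sum_(i < n.+1) f i * g (n - i)%N.
Proof. by []. Qed.

Lemma fps_mulnE f m n : (f *+ m) n = f n *+ m.
Proof. by elim: m => // m IH; rewrite !mulrS fps_addE IH. Qed.

Lemma fps_natrM m f n : (m%:R * f) n = m%:R * f n.
Proof. by rewrite !mulr_natl fps_mulnE. Qed.

Lemma fps_natrXM m j f n : (m%:R ^+ j * f) n = m%:R ^+ j * f n.
Proof. by rewrite -!natrX fps_natrM. Qed.

Lemma fps_varM f n : (fps_var * f) n = if n is n'.+1 then f n' else 0.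
Proof.
rewrite fps_mulE; case: n => [|n].
  by rewrite big_ord1 /fps_var /= mul0r.
rewrite 2!big_ord_recl /= /fps_var /= mul0r add0r mul1r /bump /= subSS subn0.
by rewrite big1 ?addr0 // => i _; rewrite mul0r.
Qed.

Lemma fps_varXM j f n : (fps_var ^+ j * f) n = if (n < j)%N then 0 else f (n - j)%N.
Proof.
elim: j n => [|j IH] n; first by rewrite mul1r subn0.
by rewrite exprS -mulrA fps_varM; case: n => [|n] //; rewrite IH.
Qed.

Lemma fps_varXM_inj j f : fps_var ^+ j * f = 0 -> f = 0.
Proof.
move=> f0; apply/funext => n.
by have := congr1 (fun h : fps R => h (n + j)%N) f0;
  rewrite fps_varXM ltnNge leq_addl addnK.
Qed.

Lemma fps_varXE j n : (fps_var ^+ j) n = (n == j)%:R.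
Proof.
rewrite -[fps_var ^+ j]mulr1 fps_varXM; case: ltngtP => // [lt_jn|->].
  by rewrite /GRing.one /= /fps_one subn_eq0 leqNgt lt_jn.
by rewrite subnn.
Qed.

Lemma fps_mul_eq f g g' n :
  (forall i, (i <= n)%N -> g i = g' i) -> (f * g) n = (f * g') n.
Proof.
by move=> gg; rewrite !fps_mulE; apply: eq_bigr => i _; rewrite gg ?leq_subr.
Qed.

Lemma fps_shift f j : (forall i, (i < j)%N -> f i = 0) ->
  f = fps_var ^+ j * (fun n => f (n + j)%N : R).
Proof.
move=> f0; apply/funext => n; rewrite fps_varXM; case: ltnP => [/f0 //|le_jn].
by rewrite subnK.
Qed.

(* Geometric series: the n-th coefficient of (1 - u h)^-1 only involves the
   powers (u h)^i with i <= n. *)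
Lemma fps_inv_1B h : exists g, (1 - fps_var * h) * g = 1.
Proof.
pose x : fps R := fps_var * h.
exists (fun n => (\sum_(i < n.+1) x ^+ i : fps R) n).
apply/funext => n.
have xE i m : (m < i)%N -> (x ^+ i) m = 0.
  by move=> lt_mi; rewrite /x exprMn fps_varXM lt_mi.
rewrite (@fps_mul_eq _ _ (\sum_(i < n.+1) x ^+ i)); last first.
  move=> m le_mn; rewrite !fps_sumE.
  rewrite -(big_mkord xpredT (fun i => (x ^+ i) m)).
  rewrite -(big_mkord xpredT (fun i => (x ^+ i) m)).
  rewrite [RHS](big_cat_nat (n := m.+1)) //= [X in _ + X]big_nat_cond.
  rewrite [X in _ = _ + X]big1 ?addr0 //.
  by move=> i /andP[/andP[lt_mi _] _]; rewrite xE.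
rewrite -opprB mulNr -subrX1 opprB.
by rewrite fps_addE fps_oppE xE // subr0.
Qed.

End PowerSeriesVariable.

(** Dividing by the constant term puts [f] in the form 1 - u h, which [fps_inv_1B] inverts. *)
Lemma fps_unit (F : fieldType) (f : fps F) : f 0%N != 0 -> exists g, f * g = 1.
Proof.
move=> f0; pose c : fps F := fun n => (n == 0%N)%:R / f 0%N.
pose h : fps F := fun n => - f n.+1 / f 0%N.
have cE : c * f = 1 - fps_var F * h.
  apply/funext => n; rewrite fps_addE fps_oppE fps_varM fps_mulE big_ord_recl.
  rewrite big1 /= ?addr0 => [|i _]; last by rewrite /c /= !mul0r.
  rewrite /c /= div1r subn0 /h /GRing.one /= /fps_one.
  case: n => [|n] /=; first by rewrite subr0 mulVf.
  by rewrite sub0r mulNr opprK mulrC.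
have [g gE] := fps_inv_1B h.
by exists (c * g); rewrite mulrA [f * c]mulrC cE.
Qed.

(** * Reduction of power series modulo p *)

Section Reduction.
Variables (W k : comNzRingType) (res : {rmorphism W -> k}).

Definition fps_map (f : fps W) : fps k := fun n => res (f n).

Fact fps_map_additive : zmod_morphism fps_map.
Proof. by move=> f g; apply/funext => n; exact: rmorphB. Qed.

Fact fps_map_multiplicative : monoid_morphism fps_map.
Proof.
split; first by apply/funext => n; rewrite /fps_map rmorph_nat.
move=> f g; apply/funext => n; rewrite /fps_map !fps_mulE rmorph_sum.
by apply: eq_bigr => i _; rewrite rmorphM.
Qed.

HB.instance Definition _ :=
  GRing.isZmodMorphism.Build (fps W) (fps k) fps_map fps_map_additive.
HB.instance Definition _ :=
  GRing.isMonoidMorphism.Build (fps W) (fps k) fps_map fps_map_multiplicative.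

Lemma fps_map_var : fps_map (fps_var W) = fps_var k.
Proof. by apply/funext => n; rewrite /fps_map rmorph_nat. Qed.

End Reduction.

Section WittSeries.
Variables (p : nat) (k : fieldType) (W : comNzRingType) (res : {rmorphism W -> k}).
Hypothesis W_witt : is_witt_ring p res.

Local Notation S := (fps W).
Local Notation u := (fps_var W).
Local Notation rho := (fps_map res).

Lemma fps_map_eq0 (s : S) : rho s = 0 <-> divides p%:R s.
Proof.
split=> [s0|[t ->]]; last first.
  apply/funext => n; rewrite /fps_map fps_natrM.
  by apply/(witt_res_ker W_witt); exists (t n).
have /choice[t tE] n : exists t, s n = p%:R * t.
  by apply/(witt_res_ker W_witt); have := congr1 (fun f : fps k => f n) s0.
by exists t; apply/funext => n; rewrite fps_natrM.
Qed.

Lemma fps_map_eq (s t : S) : rho s = rho t -> exists w, s = t + p%:R * w.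
Proof.
move=> st; have /fps_map_eq0[w wE] : rho (s - t) = 0.
  by rewrite rmorphB /= st subrr.
by exists w; rewrite -wE addrC subrK.
Qed.

Lemma fps_map_surj (f : fps k) : exists s : S, rho s = f.
Proof.
have /choice[s sE] n := witt_res_surj W_witt (f n).
by exists s; apply/funext.
Qed.

Lemma fps_map_p (s : S) : rho (p%:R * s) = 0.
Proof. by apply/fps_map_eq0; exists s. Qed.

(* [m] is the least u-adic valuation modulo p of the elements of [P]. *)
Lemma fps_valuation (P : S -> Prop) : (forall s, P s -> divides p%:R s) \/
  exists m, (forall s, P s -> exists t w, s = u ^+ m * t + p%:R * w) /\
    exists2 s, P s & forall t w, s = u ^+ m * t + p%:R * w ->
      exists g w', t * g = 1 + p%:R * w'.
Proof.
(* The least exponent whose coefficient is nonzero modulo p in some element of [P] is the common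
   valuation. *)
pose Q m := `[< exists2 s, P s & res (s m) != 0 >].
have [exQ|nexQ] := pselect (exists m, Q m); last first.
  left=> s Ps; apply/fps_map_eq0/funext => n; apply/eqP/negPn/negP => sn.
  by apply: nexQ; exists n; apply/asboolP; exists s.
right; case: (ex_minnP exQ) => m /asboolP[s0 Ps0 s0m] minm; exists m; split.
  move=> s Ps; have s_lt i : (i < m)%N -> rho s i = 0.
    move=> lt_im; apply/eqP/negPn/negP => si.
    have := minm i; rewrite leqNgt lt_im => /(_ _)/negP; apply=> //.
    by apply/asboolP; exists s.
  have [t tE] := fps_map_surj (fun n => rho s (n + m)%N).
  exists t; apply: fps_map_eq; rewrite rmorphM rmorphXn /= fps_map_var tE.
  exact: fps_shift.
(* The constant term of [t] is the coefficient of u^m in [s0] modulo p, so [t] is invertible modulo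
   p; [g] lifts its inverse. *)
exists s0 => // t w s0E.
have [|g gE] := @fps_unit _ (rho t).
  move: s0m; rewrite s0E fps_addE fps_varXM ltnn subnn rmorphD /=.
  rewrite [X in _ + X](_ : _ = rho (p%:R * w) m) // fps_map_p.
  by rewrite addr0.
have [g' g'E] := fps_map_surj g.
by exists g'; apply: fps_map_eq; rewrite rmorphM rmorph1 /= g'E.
Qed.

End WittSeries.

(** * Finitely generated modules *)

Section Submodules.
Variable R : comNzRingType.
Implicit Types V : lmodType R.

Definition is_submod V (A : V -> Prop) : Prop :=
  [/\ A 0, forall x y, A x -> A y -> A (x + y) & forall c x, A x -> A (c *: x)].

(** An arbitrary finite index type lets two families be joined over a sum type. *)
Definition fin_gen V (A : V -> Prop) : Prop :=
  exists (I : finType) (x : I -> V), (forall i, A (x i)) /\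
    forall v, A v -> exists c : I -> R, v = \sum_i c i *: x i.

Definition noetherian V : Prop := forall A : V -> Prop, is_submod A -> fin_gen A.

Lemma submodN V (A : V -> Prop) x : is_submod A -> A x -> A (- x).
Proof. by case=> _ _ AZ Ax; rewrite -scaleN1r; exact: AZ. Qed.

Lemma submodB V (A : V -> Prop) x y : is_submod A -> A x -> A y -> A (x - y).
Proof.
by move=> AS Ax Ay; case: (AS) => _ AD _; apply: AD => //; exact: submodN.
Qed.

Lemma submod_sum V (A : V -> Prop) (I : finType) (P : pred I) (c : I -> R) (x : I -> V) :
  is_submod A -> (forall i, A (x i)) -> A (\sum_(i | P i) c i *: x i).
Proof.
case=> A0 AD AZ Ax; elim/big_ind: _ => // i _; exact: AZ.
Qed.

Definition sum_case (I J : Type) (T : Type) (f : I -> T) (g : J -> T) (x : I + J) : T :=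
  match x with inl i => f i | inr j => g j end.

(** Lifts of generators of g(A), together with images of generators of the preimage of A under f,
    generate A. *)
Lemma noetherian_ext (V' V V'' : lmodType R)
    (f : {linear V' -> V}) (g : {linear V -> V''}) :
  (forall y, g y = 0 -> exists x, f x = y) -> (forall x, g (f x) = 0) ->
  noetherian V' -> noetherian V'' -> noetherian V.
Proof.
move=> ker_g gf noeth' noeth'' A AS; have [A0 AD AZ] := AS.
have [|I [z [Az genz]]] := noeth'' (fun z => exists2 a, A a & g a = z).
  split=> [|_ _ [a Aa <-] [b Ab <-]|c _ [a Aa <-]].
  - by exists 0; rewrite ?linear0.
  - by exists (a + b); [exact: AD | rewrite linearD].
  - by exists (c *: a); [exact: AZ | rewrite linearZ].
have [|J [x [Ax genx]]] := noeth' (fun x => A (f x)).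
  split=> [|a b Aa Ab|c a Aa]; first by rewrite linear0.
  - by rewrite linearD; exact: AD.
  - by rewrite linearZ; exact: AZ.
have /choice[a aE] i : exists a, A a /\ g a = z i by have [a ? ?] := Az i; exists a.
exists (I + J)%type, (sum_case a (fun j => f (x j))); split.
  by move=> [i|j]; [exact: (aE i).1 | exact: Ax].
move=> v Av; have [|c cE] := genz (g v); first by exists v.
have [|w wE] := ker_g (v - \sum_i c i *: a i).
  rewrite linearB linear_sum cE; apply/eqP; rewrite subr_eq0; apply/eqP.
  by apply: eq_bigr => i _; rewrite linearZ /= (aE i).2.
have [|d dE] := genx w.
  rewrite wE; apply: submodB => //; apply: submod_sum => // i; exact: (aE i).1.
exists (sum_case c d); rewrite big_sumType /=.
apply/eqP; rewrite addrC -subr_eq -wE dE linear_sum /=; apply/eqP.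
by apply: eq_bigr => j _; rewrite linearZ.
Qed.

End Submodules.

(** * Modules and quotients killed by p, seen over k[[u]] *)

Section WittModules.
Variables (p : nat) (k : fieldType) (W : comNzRingType) (res : {rmorphism W -> k}).
Hypothesis W_witt : is_witt_ring p res.

Local Notation S := (fps W).
Local Notation u := (fps_var W).
Local Notation rho := (fps_map res).

Lemma scale_fps_map (V : lmodType S) (x : V) (s t : S) :
  p%:R *: x = 0 -> rho s = rho t -> s *: x = t *: x.
Proof.
move=> px /(fps_map_eq W_witt)[w ->].
by rewrite scalerDl mulrC -scalerA px scaler0 addr0.
Qed.

(** This is noetherianity over k[[u]], by induction on n. Among the elements of A, one whose first
    coefficient has least u-adic valuation clears the first coefficient of all others, and the rest
    lies in the span of n - 1 vectors. *)
Lemma fin_gen_span (V : lmodType S) n (x : 'I_n -> V) (A : V -> Prop) :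
  is_submod A -> (forall i, p%:R *: x i = 0) ->
  (forall v, A v -> exists c, v = \sum_i c i *: x i) -> fin_gen A.
Proof.
elim: n x A => [|n IH] x A AS px Ax; have [A0 AD AZ] := AS.
  exists 'I_0, x; split=> [[]//|v /Ax[c ->]]; by exists c.
pose y i := x (lift ord0 i).
have py i : p%:R *: y i = 0 by exact: px.
pose P s := exists c, A (s *: x ord0 + \sum_i c i *: y i).
have AP v : A v -> exists2 s, P s & exists c, v = s *: x ord0 + \sum_i c i *: y i.
  move=> Av; have [c cE] := Ax v Av; rewrite big_ord_recl in cE.
  exists (c ord0); last by exists (fun i => c (lift ord0 i)).
  by exists (fun i => c (lift ord0 i)); rewrite -cE.
have [Pp|[m [Pm [s0 Ps0 s0u]]]] := fps_valuation W_witt P.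
  apply: (IH y) => // v /AP[s /Pp[t ->] [c ->]]; exists c.
  by rewrite mulrC -scalerA px scaler0 add0r.
have [t0 [w0 s0E]] := Pm _ Ps0; have [g [w gE]] := s0u _ _ s0E.
have [c0 Ac0] := Ps0; set a0 := _ + _ in Ac0.
pose B v := A v /\ exists c, v = \sum_i c i *: y i.
have [|//||I [z [Bz genz]]] := IH y B.
- split=> [|v v' [Av [a vE]] [Av' [b wE]]|d v [Av [a vE]]].
  + by split=> //; exists (fun=> 0); rewrite big1 // => i _; rewrite scale0r.
  + split; first exact: AD.
    exists (fun i => a i + b i); rewrite vE wE -big_split; apply: eq_bigr => i _.
    by rewrite scalerDl.
  + split; first exact: AZ.
    exists (fun i => d * a i); rewrite vE scaler_sumr; apply: eq_bigr => i _.
    by rewrite scalerA.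
- by move=> v [].
exists (unit + I)%type, (sum_case (fun=> g *: a0) z); split.
  by move=> [[]|i]; [exact: AZ | exact: (Bz i).1].
move=> v Av; have [s /Pm[t [w' sE]] [c vE]] := AP v Av.
(* Modulo p, the first coefficients of v and [a0] are u^m t and u^m t0 with t0 g = 1, so subtracting
   t g a0 clears the first one. *)
have [|d dE] := genz (v - (t * g) *: a0).
  split; first by apply: submodB => //; exact: AZ.
  exists (fun i => c i - t * g * c0 i).
  rewrite vE /a0 scalerDr scalerA opprD addrACA -scalerBl.
  rewrite (@scale_fps_map _ _ _ 0) ?scale0r ?add0r //.
    rewrite scaler_sumr -sumrB; apply: eq_bigr => i _.
    by rewrite scalerBl scalerA.
  rewrite sE s0E rmorphB !rmorphM !rmorphD /= !(fps_map_p W_witt) !addr0 rmorph0.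
  rewrite !rmorphM /= mulrCA.
  have gr : rho t0 * rho g = 1.
    by rewrite -rmorphM gE rmorphD /= (fps_map_p W_witt) addr0 rmorph1.
  by rewrite -mulrA [rho g * _]mulrC gr mulr1 subrr.
exists (sum_case (fun=> t) d); rewrite big_sumType /= -dE.
rewrite (bigD1 tt) //= big1 => [|[]//]; rewrite addr0 scalerA.
by rewrite addrC subrK.
Qed.

(* A minimal system of generators of A modulo B: a nontrivial relation can be
   divided by its u-adic content, and then expresses one generator through the
   others. *)
Lemma free_quotient_basis (V : lmodType S) (A B : V -> Prop) :
  is_submod A -> is_submod B -> (forall v, A v -> B (p%:R *: v)) ->
  (forall v, A v -> B (u *: v) -> B v) -> fin_gen A ->
  exists (n : nat) (z : 'I_n -> V),
    [/\ forall i, A (z i), forall v, A v -> exists c, B (v - \sum_i c i *: z i)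
      & forall c, B (\sum_i c i *: z i) -> forall i, divides p%:R (c i)].
Proof.
move=> AS BS pA tfA [I [x [Ax genx]]].
have [A0 AD AZ] := AS; have [B0 BD BZ] := BS.
have tfAn m v : A v -> B (u ^+ m *: v) -> B v.
  elim: m => [|m IH] Av; first by rewrite scale1r.
  by rewrite exprS -scalerA => /tfA h; apply: IH => //; apply: h; exact: AZ.
pose Q n := `[< exists z : 'I_n -> V, (forall i, A (z i)) /\
  forall v, A v -> exists c, B (v - \sum_i c i *: z i) >].
have exQ : exists n, Q n.
  exists #|I|; apply/asboolP; exists (fun i => x (enum_val i)); split=> // v /genx[c ->].
  exists (fun i => c (enum_val i)).
  by rewrite (reindex _ (onW_bij _ (@enum_val_bij I))) subrr.
case: (ex_minnP exQ) => n /asboolP[z [Az genz]] minn; exists n, z; split=> // c Bc i.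
have [cp|[m [Pm [s [l ->] cu]]]] := fps_valuation W_witt (fun s => exists l, s = c l).
  by apply: cp; exists i.
have /choice[t tE] j : exists t, exists w, c j = u ^+ m * t + p%:R * w.
  by have [|t [w cE]] := Pm (c j); [exists j | exists t, w].
have [w cl] := tE l; have [g [w' gE]] := cu _ _ cl.
(* Up to multiples of p, which land in B, the relation is u^m times the one with coefficients [t];
   torsion-freeness removes u^m. *)
have Bt : B (\sum_j t j *: z j).
  apply: (tfAn m); first exact: submod_sum.
  have /choice[ws wsE] j : exists w, c j = u ^+ m * t j + p%:R * w by exact: tE.
  have -> : u ^+ m *: (\sum_j t j *: z j) =
      \sum_j c j *: z j - p%:R *: (\sum_j ws j *: z j).
    rewrite !scaler_sumr -sumrB; apply: eq_bigr => j _.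
    by rewrite wsE scalerDl !scalerA addrK.
  by apply: submodB => //; apply: pA; exact: submod_sum.
case: n => [|n] in z Az genz minn c Bc i l cu Pm t tE w cl gE Bt *; first by have := ltn_ord l.
suff /minn : Q n by rewrite ltnn.
(* Since t_l g = 1 + p w', adding d_l g times the relation replaces z_l by the other generators,
   against the minimality of n. *)
apply/asboolP; exists (fun j => z (lift l j)); split=> // v /genz[d Bd].
exists (fun j => d (lift l j) - d l * g * t (lift l j)).
have -> : v - \sum_j (d (lift l j) - d l * g * t (lift l j)) *: z (lift l j) =
    (v - \sum_j d j *: z j) + (d l * g) *: (\sum_j t j *: z j)
    - p%:R *: ((d l * w') *: z l).
  rewrite (bigD1_ord l) //= [X in _ + _ *: X](bigD1_ord l) //=.
  rewrite (eq_bigr (fun j => d (lift l j) *: z (lift l j) -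
     (d l * g) *: (t (lift l j) *: z (lift l j)))); last first.
    by move=> j _; rewrite scalerBl !scalerA.
  rewrite sumrB -scaler_sumr.
  set X := \sum_(i0 < n) d _ *: _; set Y := \sum_(i0 < n) t _ *: _.
  rewrite scalerDr !scalerA -[_ * g * t l]mulrA [g * _]mulrC gE mulrDr mulr1.
  rewrite scalerDl [p%:R * (_ * _)]mulrCA.
  set a := d l *: z l; set q := _ *: z l; set Y' := _ *: Y.
  rewrite -[RHS]addrA -[a + q + Y']addrA [a + (q + Y')]addrCA [X in _ = _ + X]addrC.
  by rewrite addKr opprB opprD !addrA [v - a - X + a]addrAC subrK addrAC.
apply: submodB => //; last by apply: pA; apply: AZ.
by apply: BD => //; exact: BZ.
Qed.

End WittModules.

(** * Modules with a basis of p-power torsion elements *)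

Section TorsionBasis.
Variables (p : nat) (W : comNzRingType).
Local Notation S := (fps W).

(** For a submodule A, this says that A is the internal direct sum of the spans of the x_j, with the
    span of x_j isomorphic to S/p^(a j). *)
Definition tors_basis (V : lmodType S) (A : V -> Prop) (J : finType)
    (x : J -> V) (a : J -> nat) : Prop :=
  [/\ forall j, A (x j), forall j, p%:R ^+ a j *: x j = 0,
      forall v, A v -> exists c, v = \sum_j c j *: x j
    & forall c, \sum_j c j *: x j = 0 -> forall j, divides (p%:R ^+ a j) (c j)].

Section Quotient.
Variable c : S.
Local Notation proj := (\pi_((Quotient.quot (princ c)))%qT).

(** The projection is retyped into [cycmod], the type that carries the S-module structure. *)
Definition cyc_proj (s : S) : cycmod c := proj s.

Lemma cyc_projP s t : cyc_proj s = cyc_proj t <-> divides c (s - t).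
Proof.
split=> [/eqP|st]; last apply/eqP; rewrite -Quotient.idealrBE; first by move=> /asboolP.
exact/asboolP.
Qed.

Lemma cyc_proj_repr (x : cycmod c) : cyc_proj (repr (x : Quotient.quot (princ c))) = x.
Proof. exact: reprK. Qed.

Lemma cyc_projD s t : cyc_proj (s + t) = cyc_proj s + cyc_proj t.
Proof. exact: (raddfD proj). Qed.

Lemma cyc_projZ s t : cyc_proj (s * t) = s *: cyc_proj t.
Proof.
apply/cyc_projP; rewrite -mulrBr.
have /cyc_projP[y ->] := esym (cyc_proj_repr (cyc_proj t)).
by exists (s * y); rewrite mulrCA.
Qed.

Lemma cyc_proj_eq0 s : cyc_proj s = 0 <-> divides c s.
Proof.
have -> : 0 = cyc_proj 0 by rewrite -[0 in RHS](mulr0 0) cyc_projZ scale0r.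
by split=> [/cyc_projP|?]; last apply/cyc_projP; rewrite subr0.
Qed.

End Quotient.

Lemma dsum_sumE n (V : 'I_n -> lmodType S) (I : Type) (s : seq I) (P : pred I)
    (F : I -> dsum V) j :
  (\sum_(i <- s | P i) F i) j = \sum_(i <- s | P i) F i j.
Proof. exact: (big_morph (fun x : dsum V => x j)). Qed.

(** Coordinates in the basis are chosen arbitrarily, but they are unique modulo p^(b i), so they
    become linear after projection to the cyclic summands. *)
Lemma torsion_sum_of_basis (V : lmodType S) (J : finType) (x : J -> V) (a : J -> nat) :
  tors_basis (fun=> True) x a ->
  exists (n : nat) (b : 'I_n -> nat), lmod_isom V (torsion_sum p W b).
Proof.
case=> _ px genx indx.
pose n := #|J|; pose y (i : 'I_n) := x (enum_val i); pose b (i : 'I_n) := a (enum_val i).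
have re (c : J -> S) : \sum_j c j *: x j = \sum_i c (enum_val i) *: y i.
  by rewrite (reindex _ (onW_bij _ (@enum_val_bij J))).
have /choice[crd crdE] v : exists c, v = \sum_i c i *: y i.
  by have [c ->] := genx v I; exists (fun i => c (enum_val i)).
have indy c d : \sum_i c i *: y i = \sum_i d i *: y i ->
    forall i, divides (p%:R ^+ b i) (c i - d i).
  move=> cd i.
  have := indx (fun j => c (enum_rank j) - d (enum_rank j)).
  rewrite re (eq_bigr (fun i => c i *: y i - d i *: y i)); last first.
    by move=> j _; rewrite enum_valK scalerBl.
  by rewrite sumrB cd subrr => /(_ erefl (enum_val i)); rewrite enum_valK.
exists n, b; pose T := torsion_sum p W b.
pose F (v : V) : T := fun i => cyc_proj _ (crd v i).
have linF : linear F.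
  move=> s v w; apply: functional_extensionality_dep => i.
  rewrite /F [RHS](_ : _ = s *: cyc_proj _ (crd v i) + cyc_proj _ (crd w i)) //.
  rewrite -cyc_projZ -cyc_projD; apply/cyc_projP.
  apply: (indy _ (fun j => s * crd v j + crd w j)).
  rewrite -crdE {1}[v]crdE {1}[w]crdE scaler_sumr -big_split.
  by apply: eq_bigr => j _; rewrite scalerDl scalerA.
exists (HB.pack_for {linear V -> T} F (GRing.isLinear.Build S V T *:%R F linF)).
pose G (t : T) : V :=
  \sum_i repr (t i : Quotient.quot (princ (p%:R ^+ b i))) *: y i.
exists G => [v|t] /=.
  rewrite /G [RHS]crdE; apply: eq_bigr => i _.
  have /cyc_projP[w wE] : cyc_proj (p%:R ^+ b i)
    (repr (F v i : Quotient.quot (princ (p%:R ^+ b i)))) = cyc_proj _ (crd v i).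
    by rewrite cyc_proj_repr.
  by apply/eqP; rewrite -subr_eq0 -scalerBl wE mulrC -scalerA px scaler0.
apply: functional_extensionality_dep => i.
rewrite /F -[RHS]cyc_proj_repr; apply/cyc_projP.
exact: (indy _ (fun i => repr (t i : Quotient.quot (princ (p%:R ^+ b i))))).
Qed.

Lemma basis_of_torsion_sum (V : lmodType S) n (a : 'I_n -> nat) :
  lmod_isom V (torsion_sum p W a) -> exists x, @tors_basis V (fun=> True) 'I_n x a.
Proof.
case=> f [g fK gK].
pose delta (i : 'I_n) : torsion_sum p W a := fun j => cyc_proj _ (j == i)%:R.
have deltaE (c : 'I_n -> S) j : (\sum_i c i *: delta i) j = cyc_proj _ (c j).
  rewrite dsum_sumE (bigD1 j) //= big1 ?addr0.
    by rewrite [LHS](_ : _ = c j *: delta j j) // -cyc_projZ eqxx mulr1.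
  move=> i ij; rewrite [LHS](_ : _ = c i *: delta i j) // -cyc_projZ.
  by rewrite eq_sym (negPf ij) mulr0; apply/cyc_proj_eq0; exists 0; rewrite mulr0.
have fE c : f (\sum_i c i *: g (delta i)) = \sum_i c i *: delta i.
  by rewrite linear_sum; apply: eq_bigr => i _; rewrite linearZ /= gK.
exists (fun i => g (delta i)); split=> //.
- move=> i; apply: (can_inj fK); rewrite linearZ linear0 /= gK.
  apply: functional_extensionality_dep => j.
  rewrite [LHS](_ : _ = p%:R ^+ a i *: delta i j) // -cyc_projZ.
  apply/cyc_proj_eq0; case: eqP => [->|_]; last by exists 0; rewrite !mulr0.
  by exists 1.
- move=> v _; exists (fun i => repr (f v i : Quotient.quot (princ (p%:R ^+ a i)))).
  apply: (can_inj fK); rewrite fE; apply: functional_extensionality_dep => j.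
  by rewrite deltaE cyc_proj_repr.
- move=> c c0 j; apply/cyc_proj_eq0; rewrite -deltaE -fE c0.
  by rewrite linear0.
Qed.

End TorsionBasis.

(** * Dividing a basis by p *)

Section BasisLift.
Variables (p : nat) (k : fieldType) (W : comNzRingType) (res : {rmorphism W -> k}).
Hypothesis W_witt : is_witt_ring p res.
Local Notation S := (fps W).
Local Notation u := (fps_var W).

Variable (V : lmodType S).
Hypothesis V_noeth : noetherian V.

Definition pmult (A : V -> Prop) (v : V) : Prop := exists2 w, A w & v = p%:R *: w.

Lemma pmult_submod A : is_submod A -> is_submod (pmult A).
Proof.
case=> A0 AD AZ; split.
- by exists 0; rewrite ?scaler0.
- by move=> _ _ [v Av ->] [w Aw ->]; exists (v + w); [exact: AD | rewrite scalerDr].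
- move=> c _ [v Av ->]; exists (c *: v); first exact: AZ.
  by rewrite !scalerA mulrC.
Qed.

(* Each basis vector y_j = p x_j of pA is divided by p, and the x_j are completed
   by a basis of the k[[u]]-module A[p] / (A[p] \cap pA), which is free since it
   is finitely generated and torsion free. *)
Lemma tors_basis_lift (A : V -> Prop) (J : finType) (y : J -> V) (b : J -> nat) :
  is_submod A -> (forall v, A v -> pmult A (u *: v) -> pmult A v) ->
  tors_basis p (pmult A) y b -> (forall j, 0 < b j)%N ->
  exists (I : finType) (x : I -> V) (a : I -> nat),
    tors_basis p A x a /\ (forall i, 0 < a i)%N.
Proof.
move=> AS tfA [Ay py geny indy] b_gt0; have [A0 AD AZ] := AS.
have BS := pmult_submod AS; have [B0 BD BZ] := BS.
have /choice[x xE] j : exists x, A x /\ y j = p%:R *: x.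
  by have [x ? ?] := Ay j; exists x.
pose A1 v := A v /\ p%:R *: v = 0.
have A1S : is_submod A1.
  split=> [|v w [Av pv] [Aw pw]|c v [Av pv]].
  - by split; rewrite ?scaler0.
  - by split; [exact: AD | rewrite scalerDr pv pw addr0].
  - by split; [exact: AZ | rewrite scalerA mulrC -scalerA pv scaler0].
have [||n [z [Az genz indz]]] :=
    free_quotient_basis W_witt A1S BS _ _ (V_noeth A1S).
- by move=> v [_ ->].
- by move=> v [Av _]; exact: tfA.
(* Dividing y_j by p raises its exponent by one; the new vectors z_i are killed by p. *)
pose ex := @sum_case J 'I_n nat (fun j => (b j).+1) (fun=> 1%N).
exists (J + 'I_n)%type, (sum_case x z), ex; split; last by case.
have sumE (c : J + 'I_n -> S) : \sum_i c i *: sum_case x z i =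
    \sum_j c (inl j) *: x j + \sum_i c (inr i) *: z i by rewrite big_sumType.
have pyE (c : J -> S) : p%:R *: (\sum_j c j *: x j) = \sum_j c j *: y j.
  rewrite scaler_sumr; apply: eq_bigr => j _.
  by rewrite (xE j).2 !scalerA mulrC.
split.
- by move=> [j|i] /=; [exact: (xE j).1 | exact: (Az i).1].
- move=> [j|i] /=; last exact: (Az i).2.
  by rewrite exprSr -scalerA -(xE j).2.
(* Subtracting the x_j-combination with the same multiple by p leaves an element of A[p]. The z_i
   express it modulo pA, and the error in pA is expanded in the y_j = p x_j. *)
- move=> v Av; have [|c cE] := geny (p%:R *: v); first by exists v.
  have [|d [w Aw wE]] := genz (v - \sum_j c j *: x j).
    split; last by rewrite scalerBr cE pyE subrr.
    by apply: submodB => //; apply: submod_sum => // j; exact: (xE j).1.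
  have [|c' c'E] := geny (p%:R *: w); first by exists w.
  exists (sum_case (fun j => c j + c' j * p%:R) d).
  rewrite sumE /=.
  rewrite (eq_bigr (fun j => c j *: x j + c' j *: y j)); last first.
    by move=> j _; rewrite scalerDl (xE j).2 scalerA.
  rewrite big_split /= -c'E -wE.
  set X := \sum_j _; set Z := \sum_i _.
  by rewrite -addrA subrK addrC subrK.
(* Multiplying by p kills the z-part, so p^(b j) divides c_j and, as b_j > 0, c_j = d_j p. The
   x-part is then in pA, hence so is the z-part, whose coefficients are divisible by p; it vanishes.
   What remains is a relation among the y_j with coefficients d_j, which gains the missing factor
   p. *)
- move=> c; rewrite sumE => c0.
  have /indy cb : \sum_j c (inl j) *: y j = 0.
    rewrite -pyE; move/(congr1 (fun v => p%:R *: v)): c0.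
    rewrite scalerDr scaler0 [X in _ + X](_ : _ = 0) ?addr0 //.
    rewrite scaler_sumr big1 // => i _.
    by rewrite scalerA mulrC -scalerA (Az i).2 scaler0.
  have /choice[d dE] j : exists d, c (inl j) = d * p%:R.
    have [w ->] := cb j; exists (p%:R ^+ (b j).-1 * w).
    by rewrite [RHS]mulrC mulrA -exprS prednK.
  have cx : \sum_j c (inl j) *: x j = \sum_j d j *: y j.
    by apply: eq_bigr => j _; rewrite dE -scalerA (xE j).2.
  have /indz cz : pmult A (\sum_i c (inr i) *: z i).
    have -> : \sum_i c (inr i) *: z i = - \sum_j d j *: y j.
      by apply/eqP; rewrite -addr_eq0 -cx addrC c0.
    by apply: submodN => //; exact: submod_sum.
  have cz0 : \sum_i c (inr i) *: z i = 0.
    apply: big1 => i _; have [w ->] := cz i.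
    by rewrite mulrC -scalerA (Az i).2 scaler0.
  move=> [j|i] /=; last exact: cz.
  have /indy dy : \sum_j d j *: y j = 0 by rewrite -cx; move: c0; rewrite cz0 addr0.
  by have [w wE] := dy j; exists w; rewrite dE wE exprS mulrC mulrA.
Qed.

Lemma tors_basis_exists N :
  (forall v : V, p%:R ^+ N *: v = 0) ->
  (forall i (v w : V), u *: (p%:R ^+ i *: v) = p%:R ^+ i.+1 *: w ->
     exists w', p%:R ^+ i *: v = p%:R ^+ i.+1 *: w') ->
  exists (I : finType) (x : I -> V) (a : I -> nat), tors_basis p (fun=> True) x a.
Proof.
move=> pN tf; pose P i v := exists w : V, v = p%:R ^+ i *: w.
have PS i : pmult (P i) = P i.+1.
  apply/funext => v; apply/propext; split=> [[_ [w ->] ->]|[w ->]].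
    by exists w; rewrite scalerA exprS.
  by exists (p%:R ^+ i *: w); [exists w | rewrite scalerA exprS].
have PM i : is_submod (P i).
  split=> [|_ _ [v ->] [w ->]|c _ [v ->]].
  - by exists 0; rewrite scaler0.
  - by exists (v + w); rewrite scalerDr.
  - by exists (c *: v); rewrite !scalerA mulrC.
(* The induction starts from p^N V = 0 with the empty basis and ends at V. Positivity of the
   exponents is carried along because [tors_basis_lift] requires it. *)
suff /(_ N (leqnn N)) [I [x [a [[_ ax genx indx] _]]]] :
    forall i, (i <= N)%N -> exists (I : finType) (x : I -> V) (a : I -> nat),
    tors_basis p (P (N - i)%N) x a /\ (forall i, 0 < a i)%N.
  exists I, x, a; split=> // v _; apply: genx.
  by exists v; rewrite subnn scale1r.
elim=> [|i IH] le_iN.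
  exists void, (of_void V), (fun=> 0%N); split; last by case.
  split=> [[]|[]|v [w ->]|c _ []] //.
  by exists (fun=> 0); rewrite subn0 pN big1 // => -[].
have [I [x [a [xa a_gt0]]]] := IH (ltnW le_iN).
have Ni : (N - i = (N - i.+1).+1)%N by rewrite subnSK.
apply: tors_basis_lift (PM _) _ _ a_gt0; last by rewrite PS -Ni; exact: xa.
by move=> v [w ->]; rewrite PS => -[w' /tf].
Qed.

End BasisLift.

(** * Frobenius modules *)

Section FrobeniusModules.
Variables (p : nat) (p_prime : prime p).
Variables (k : fieldType) (k_perfect : perfect_field p k).
Variables (W : comNzRingType) (res : {rmorphism W -> k}).
Hypothesis W_witt : is_witt_ring p res.
Variables (sigma : {rmorphism W -> W}) (sigma_frob : is_witt_frobenius p sigma).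

Local Notation S := (fps W).
Local Notation u := (fps_var W).
Local Notation rho := (fps_map res).
Local Notation frob := (fps_frob p sigma).

Let p_gt0 : (0 < p)%N := prime_gt0 p_prime.

Lemma res_sigma x : res (sigma x) = res x ^+ p.
Proof.
apply/eqP; rewrite -subr_eq0 -rmorphXn -rmorphB /=; apply/eqP.
exact/(witt_res_ker W_witt)/sigma_frob.
Qed.

(** Perfectness of k makes [sigma] surjective modulo p, and each round of correction gains one power
    of p. Finite precision suffices for modules killed by a power of p. *)
Lemma sigma_surj_mod N x : exists y t, x = sigma y + p%:R ^+ N * t.
Proof.
elim: N => [|N [y [t ->]]]; first by exists 0, x; rewrite rmorph0 mul1r add0r.
have [a aE] := k_perfect.2 (res t); have [y' y'E] := witt_res_surj W_witt a.
have /(witt_res_ker W_witt)[t' t'E] : res (t - sigma y') = 0.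
  by rewrite rmorphB /= res_sigma y'E aE subrr.
exists (y + p%:R ^+ N * y'), t'.
rewrite rmorphD rmorphM rmorphXn rmorph_nat /= -addrA; congr (_ + _).
by rewrite exprSr -mulrA -mulrDr -t'E addrC subrK.
Qed.

(** Only exponents divisible by p occur in frob(c_j), so the coefficient of u^n comes from the
    single index j = n mod p. *)
Lemma frob_sumE (c : 'I_p -> S) n :
  (\sum_(j < p) u ^+ j * frob (c j)) n = sigma (c (Ordinal (ltn_pmod n p_gt0)) (n %/ p)%N).
Proof.
rewrite fps_sumE (bigD1 (Ordinal (ltn_pmod n p_gt0))) //= big1 ?addr0.
  rewrite fps_varXM ltnNge leq_mod /= /fps_frob.
  have -> : (n - n %% p = n %/ p * p)%N by rewrite {1}(divn_eq n p) addnK.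
  by rewrite dvdn_mull // mulnK.
move=> j jn; rewrite fps_varXM; case: ltnP => // le_jn; rewrite /fps_frob.
case: ifP => // /dvdnP[q qE]; case/eqP: jn; apply: val_inj => /=.
by rewrite -(subnK le_jn) qE modnMDl modn_small.
Qed.

Lemma frob_decomposition N (s : S) : exists (c : 'I_p -> S) t,
  s = \sum_(j < p) u ^+ j * frob (c j) + p%:R ^+ N * t.
Proof.
have /choice[y yE] n := sigma_surj_mod N (s n).
have /choice[t tE] := yE.
exists (fun j n => y (n * p + j)%N), t; apply/funext => n.
by rewrite fps_addE frob_sumE fps_natrXM /= -divn_eq.
Qed.

Lemma frob_varX q : frob (u ^+ q) = u ^+ (p * q).
Proof.
apply/funext => n; rewrite /fps_frob !fps_varXE rmorph_nat.
case: ifP => [/dvdnP[m ->]|ndvd]; first by rewrite mulnK // mulnC eqn_pmul2l.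
by case: eqP => // nE; rewrite nE dvdn_mulr in ndvd.
Qed.

(** The residue classes of exponents modulo p do not interact, and x |-> x^p is injective on k. *)
Lemma fps_map_frob_sum (c : 'I_p -> S) :
  rho (\sum_(j < p) u ^+ j * frob (c j)) = 0 -> forall j, rho (c j) = 0.
Proof.
move=> c0 j; apply/funext => n.
have := congr1 (fun f : fps k => f (n * p + j)%N) c0.
rewrite /fps_map frob_sumE res_sigma => /eqP.
rewrite expf_eq0 p_gt0 /= divnMDl // divn_small // addn0 => /eqP.
by congr (res (c _ _) = _); apply: val_inj; rewrite /= modnMDl modn_small.
Qed.

Variables (E : {poly W}) (r d : nat).
Hypothesis E_mod : rho (fps_of_poly E) = fps_var k ^+ d.
Hypothesis dr_lt : (d * r < p - 1)%N.

Local Notation phiMod := (phiMod p sigma E r).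

Lemma phi0 (M : phiMod) : phi (0 : M) = 0.
Proof.
by apply: (addrI (phi (0 : M))); rewrite -phi_additive !addr0.
Qed.

Lemma phiN (M : phiMod) (x : M) : phi (- x) = - phi x.
Proof. by apply: (addrI (phi x)); rewrite -phi_additive !subrr phi0. Qed.

Lemma phi_sum (M : phiMod) (I : Type) (s : seq I) (P : pred I) (F : I -> M) :
  phi (\sum_(i <- s | P i) F i) = \sum_(i <- s | P i) phi (F i).
Proof. exact: (big_morph _ (@phi_additive _ _ _ _ _ M) (phi0 M)). Qed.

Lemma phi_pX (M : phiMod) i (x : M) : phi (p%:R ^+ i *: x) = p%:R ^+ i *: phi x.
Proof.
rewrite -natrX !scaler_nat; elim: (p ^ i)%N => [|n IH]; first by rewrite !mulr0n phi0.
by rewrite !mulrS phi_additive IH.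
Qed.

Lemma phi_varX (M : phiMod) j q (x : M) :
  u ^+ j *: phi (u ^+ q *: x) = u ^+ (p * q + j) *: phi x.
Proof. by rewrite phi_semilinear frob_varX scalerA -exprD addnC. Qed.

(* Injectivity of the linearization S (x)_phi M -> M: by [frob_decomposition],
   u^0, ..., u^(p-1) generate S over its Frobenius image, up to powers of p. *)
Definition lin_inj (M : phiMod) : Prop :=
  forall m : 'I_p -> M, \sum_(j < p) u ^+ j *: phi (m j) = 0 -> forall j, m j = 0.

Definition pX_killed (V : lmodType S) : Prop :=
  exists N, forall v : V, p%:R ^+ N *: v = 0.

(** With A the matrix of phi, the height condition gives B with A B = u^(dr) over k[[u]]. Then det A
    det B is a power of u, so the phi(b_j) are independent modulo p. *)
Lemma lin_inj_Mod1 (M : phiMod) : Mod1 M -> lin_inj M.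
Proof.
case=> n /basis_of_torsion_sum[b [_ pb genb indb]].
have /choice[crd crdE] v : exists c, v = \sum_i c i *: b i by exact: genb.
have ind c : \sum_i c i *: b i = 0 -> forall i, rho (c i) = 0.
  by move=> /indb c0 i; apply/(fps_map_eq0 W_witt); have := c0 i.
pose A : 'M[S]_n := \matrix_(i, j) crd (phi (b j)) i.
have phibE (c : 'I_n -> S) :
    \sum_j c j *: phi (b j) = \sum_i (\sum_j A i j * c j) *: b i.
  under [RHS]eq_bigr => i _ do rewrite scaler_suml.
  rewrite exchange_big; apply: eq_bigr => j _.
  rewrite {1}[phi (b j)]crdE scaler_sumr; apply: eq_bigr => i _.
  by rewrite scalerA mxE mulrC.
have phiE v : phi v = \sum_j frob (crd v j) *: phi (b j).
  by rewrite {1}[v]crdE phi_sum; apply: eq_bigr => j _; rewrite phi_semilinear.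
have /choice[B BE] l : exists c : 'I_n -> S,
    fps_of_poly E ^+ r *: b l = \sum_j c j *: phi (b j).
  have [m [s [x ->]]] := phiMod_height (b l).
  exists (fun j => \sum_i s i * frob (crd (x i) j)).
  under [RHS]eq_bigr => i _ do rewrite scaler_suml.
  rewrite exchange_big; apply: eq_bigr => i _.
  by rewrite {1}phiE scaler_sumr; apply: eq_bigr => j _; rewrite scalerA.
pose rA : 'M[fps k]_n := map_mx rho A.
pose rB : 'M[fps k]_n := \matrix_(j, l) rho (B l j).
have ABE : rA *m rB = (fps_var k ^+ d ^+ r)%:M.
  apply/matrixP => i l; rewrite !mxE.
  have /ind/(_ i) : \sum_i (\sum_j A i j * B l j - fps_of_poly E ^+ r *+ (i == l)) *: b i = 0.
    under eq_bigr => j _ do rewrite scalerBl.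
    rewrite sumrB -phibE -BE (bigD1 l) //= eqxx mulr1n big1 ?addr0 ?subrr //.
    by move=> j /negPf->; rewrite mulr0n scale0r.
  rewrite rmorphB rmorphMn rmorphXn /= E_mod => /eqP; rewrite subr_eq0 => /eqP <-.
  by rewrite rmorph_sum; apply: eq_bigr => j _; rewrite rmorphM !mxE.
have phib_inj (c : 'I_n -> S) : \sum_j c j *: phi (b j) = 0 -> forall j, rho (c j) = 0.
  rewrite phibE => /ind c0 j; pose rc : 'cV[fps k]_n := \col_j rho (c j).
  have Ac : rA *m rc = 0.
    apply/matrixP => i l; rewrite !mxE -[RHS](c0 i) rmorph_sum.
    by apply: eq_bigr => j' _; rewrite rmorphM !mxE.
  have : \det rA *: rc = 0 by rewrite -mul_scalar_mx -mul_adj_mx -mulmxA Ac mulmx0.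
  move=> /(congr1 (fun x => \det rB *: x)); rewrite scalerA scaler0 mulrC -det_mulmx.
  rewrite ABE det_scalar -!exprM => /matrixP/(_ j 0); rewrite !mxE.
  exact: fps_varXM_inj.
move=> m m0 i; rewrite [m i]crdE.
(* Regrouping by basis vectors turns the hypothesis into a relation among the phi(b_j);
   [fps_map_frob_sum] then separates the p terms of each coefficient. *)
have cE : \sum_j (\sum_(i < p) u ^+ i * frob (crd (m i) j)) *: phi (b j) = 0.
  rewrite -[RHS]m0; under eq_bigr => j _ do rewrite scaler_suml.
  rewrite exchange_big; apply: eq_bigr => i' _.
  by rewrite [in RHS]phiE scaler_sumr; apply: eq_bigr => j _; rewrite scalerA.
apply: big1 => j _; have := phib_inj _ cE j.
move=> /fps_map_frob_sum /(_ i) /(fps_map_eq0 W_witt)[w ->].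
by rewrite mulrC -scalerA (pb j) scaler0.
Qed.

(** All three properties pass to extensions. For injectivity, the case of M'' shows that the m_j
    come from M', where the case of M' applies. *)
Lemma ModInf_properties (M : phiMod) :
  ModInf M -> [/\ lin_inj M, noetherian M & pX_killed M].
Proof.
elim=> {M} [M M1|M' M M'' f g [fphi gphi f_inj _ kerg] _ [inj' no' [N' k']]
    _ [inj'' no'' [N'' k'']]].
  have M_inj := lin_inj_Mod1 M1.
  have [n /basis_of_torsion_sum[b [_ pb genb indb]]] := M1; split=> //.
    by move=> A AS; apply: (fin_gen_span W_witt AS pb) => v _; exact: genb.
  exists 1%N => v; have [//|c ->] := genb v.
  by rewrite scaler_sumr big1 // => i _; rewrite scalerA mulrC -scalerA pb scaler0.
have gf x : g (f x) = 0 by apply/kerg; exists x.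
split.
- move=> m m0 j.
  have /choice[m' m'E] i : exists x, f x = m i.
    apply/kerg; apply: (inj'' (fun j => g (m j))).
    transitivity (g (\sum_(j < p) u ^+ j *: phi (m j))); last by rewrite m0 linear0.
    by rewrite linear_sum; apply: eq_bigr => l _; rewrite linearZ /= gphi.
  rewrite -m'E (inj' m') ?linear0 //; apply: f_inj; rewrite linear0 -[RHS]m0 linear_sum.
  by apply: eq_bigr => l _; rewrite linearZ /= fphi m'E.
- by apply: (noetherian_ext (f := f) (g := g)) => // y /kerg.
- exists (N' + N'')%N => v.
  have /kerg[x xE] : g (p%:R ^+ N'' *: v) = 0 by rewrite linearZ /= k''.
  by rewrite exprD -scalerA -xE -linearZ k' linear0.
Qed.

(** * The u-torsion of p^i M / p^(i+1) M *)

Section Saturation.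
Variable M : phiMod.
Hypothesis M_inj : lin_inj M.
Hypothesis M_noeth : noetherian M.
Hypothesis M_killed : pX_killed M.

(** The coefficients are decomposed modulo a power p^N that kills M, so the remainder acts as
    zero. *)
Lemma frob_normal_form (I : finType) (s : I -> S) (m : I -> M) :
  exists m' : 'I_p -> M, \sum_i s i *: phi (m i) = \sum_(j < p) u ^+ j *: phi (m' j).
Proof.
have [N kN] := M_killed.
have /choice[c cE] i := frob_decomposition N (s i).
have /choice[t tE] := cE.
exists (fun j => \sum_i c i j *: m i).
under [RHS]eq_bigr => j _ do rewrite phi_sum scaler_sumr.
rewrite exchange_big; apply: eq_bigr => i _.
rewrite {1}tE scalerDl -[X in _ + X]scalerA kN addr0 scaler_suml.
by apply: eq_bigr => j _; rewrite phi_semilinear scalerA.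
Qed.

Variable i : nat.

(** The condition that u^n kills all u-power torsion of p^i M / p^(i+1) M. *)
Let bounded n := forall (v : M),
  (exists m w, u ^+ m *: (p%:R ^+ i *: v) = p%:R ^+ i.+1 *: w) ->
  exists w, u ^+ n *: (p%:R ^+ i *: v) = p%:R ^+ i.+1 *: w.

(** The v whose class p^i v is torsion form a submodule, finitely generated by noetherianity; the
    sum of exponents killing the generators works. *)
Let bounded_exists : exists n, bounded n.
Proof.
have [|I [x [satx genx]]] := M_noeth (A := fun v => exists m w,
    u ^+ m *: (p%:R ^+ i *: v) = p%:R ^+ i.+1 *: w).
  split=> [|v v' [m [w mE]] [m' [w' mE']]|c v [m [w mE]]].
  - by exists 0%N, 0; rewrite !scaler0.
  - exists (m + m')%N, (u ^+ m' *: w + u ^+ m *: w'); rewrite !scalerDr.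
    rewrite {1}addnC !exprD -!scalerA mE mE' !scalerA.
    by congr (_ *: _ + _ *: _); rewrite mulrC.
  - exists m, (c *: w); transitivity (c *: (u ^+ m *: (p%:R ^+ i *: v))).
      by rewrite !scalerA; congr (_ *: _); rewrite ?mulrA [LHS]mulrC !mulrA.
    by rewrite mE !scalerA mulrC.
have /choice[m mP] := satx; have /choice[w wP] := mP.
exists (\sum_j m j)%N => v /genx[c ->].
exists (\sum_j (c j * u ^+ (\sum_(l | l != j) m l)) *: w j).
rewrite !scaler_sumr; apply: eq_bigr => j _.
rewrite (bigD1 j) //= addnC exprD.
transitivity ((c j * u ^+ (\sum_(l | l != j) m l)) *:
  (u ^+ m j *: (p%:R ^+ i *: x j))).
  by rewrite !scalerA; congr (_ *: _); rewrite ?mulrA [LHS]mulrC !mulrA.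
by rewrite wP !scalerA mulrC.
Qed.

(* If u^n kills the u-torsion of p^i M / p^(i+1) M, then injectivity of the
   linearization shows that so does u^q with q = (dr + n) / p. *)
Let bounded_step n : bounded n -> bounded ((d * r + n) %/ p)%N.
Proof.
move=> bn v [m [w vE]].
have [|y yE] := bn (phi v).
  exists (p * m)%N, (phi w); rewrite -!phi_pX -vE.
  by rewrite [RHS]phi_semilinear frob_varX.
have [e' eE] : exists e', fps_of_poly E ^+ r = u ^+ (d * r) + p%:R * e'.
  apply: (fps_map_eq W_witt); rewrite !rmorphXn /= E_mod fps_map_var.
  by rewrite -exprM.
have [n' [s [x hE]]] := phiMod_height y.
(* The extra term -e' u^n phi(v) cancels the p e' in E^r = u^(dr) + p e', so that p^(i+1) times the
   whole sum is exactly u^(dr+n) phi(p^i v). *)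
have [m'] := frob_normal_form (sum_case s (fun _ : unit => - (e' * u ^+ n)))
  (sum_case x (fun=> v)).
rewrite big_sumType /= -hE (bigD1 tt) //= big1 => [|[]//]; rewrite addr0 => m'E.
pose j0 := Ordinal (ltn_pmod (d * r + n) p_gt0).
set q := (_ %/ p)%N; exists (m' j0).
(* With dr + n = p q + j0, u^(dr+n) phi(x) = u^j0 phi(u^q x). So [z] is in the kernel of the
   linearization, and its entry at j0 is the desired equality. *)
pose z (j : 'I_p) := (if j == j0 then u ^+ q *: (p%:R ^+ i *: v) else 0)
  - p%:R ^+ i.+1 *: m' j.
suff /M_inj/(_ j0)/eqP : \sum_(j < p) u ^+ j *: phi (z j) = 0.
  by rewrite /z eqxx subr_eq0 => /eqP.
have -> : \sum_(j < p) u ^+ j *: phi (z j) =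
    u ^+ j0 *: phi (u ^+ q *: (p%:R ^+ i *: v)) -
    p%:R ^+ i.+1 *: \sum_(j < p) u ^+ j *: phi (m' j).
  rewrite (eq_bigr (fun j : 'I_p =>
    u ^+ j *: phi (if j == j0 then u ^+ q *: (p%:R ^+ i *: v) else 0) -
    p%:R ^+ i.+1 *: (u ^+ j *: phi (m' j)))); last first.
    move=> j _; rewrite phi_additive phiN phi_pX scalerBr; congr (_ - _).
    by rewrite !scalerA mulrC.
  rewrite sumrB -scaler_sumr; congr (_ - _).
  rewrite (bigD1 j0) //= eqxx big1 ?addr0 // => j /negPf->.
  by rewrite phi0 scaler0.
rewrite -m'E phi_varX phi_pX mulnC -divn_eq.
have -> : p%:R ^+ i.+1 *: (fps_of_poly E ^+ r *: y + - (e' * u ^+ n) *: phi v) =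
   fps_of_poly E ^+ r *: (p%:R ^+ i.+1 *: y) - (p%:R ^+ i.+1 * (e' * u ^+ n)) *: phi v.
  by rewrite scalerDr scaleNr scalerN !scalerA [_ * fps_of_poly E ^+ r]mulrC.
rewrite -yE eE exprD !scalerA -!scalerBl exprSr.
rewrite [X in X *: _](_ : _ = 0) ?scale0r //.
rewrite !mulrDl !mulrA.
have -> : p%:R ^+ i * p%:R * e' * u ^+ n = p%:R * e' * u ^+ n * p%:R ^+ i.
  by rewrite -!mulrA mulrC !mulrA.
by rewrite addrK subrr.
Qed.

Lemma gr_torsion_free (v w : M) : u *: (p%:R ^+ i *: v) = p%:R ^+ i.+1 *: w ->
  exists w', p%:R ^+ i *: v = p%:R ^+ i.+1 *: w'.
Proof.
move=> vE; have exb : exists n, `[< bounded n >].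
  by have [n ?] := bounded_exists; exists n; apply/asboolP.
case: (ex_minnP exb) => -[|n] /asboolP bn minn.
  have [|w' w'E] := bn v; first by exists 1%N, w.
  by exists w'; rewrite -w'E scale1r.
(* Minimality of n + 1 would give (n + 1) p <= dr + n + 1, that is (n + 1)(p - 1) <= dr, against dr
   < p - 1. *)
have /asboolT/minn : bounded ((d * r + n.+1) %/ p)%N by exact: bounded_step.
rewrite leq_divRL // leqNgt -[X in (_ < _ * X)%N](subnK p_gt0).
rewrite mulnDr muln1 ltn_add2r.
by rewrite (leq_trans dr_lt) // leq_pmull.
Qed.

End Saturation.

Lemma ModInf_torsion_sum (M : phiMod) : ModInf M ->
  exists (n : nat) (a : 'I_n -> nat), lmod_isom M (torsion_sum p W a).
Proof.
move=> /ModInf_properties[M_inj M_noeth M_killed].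
have [N kN] := M_killed.
have [i v w|J [x [a xa]]] := tors_basis_exists W_witt M_noeth kN.
  exact: gr_torsion_free.
exact: torsion_sum_of_basis xa.
Qed.

End FrobeniusModules.

(** * Eisenstein polynomials *)

Lemma dval1 (K : fieldType) (v : discreteValuation K) : v 1 = 0.
Proof.
have := dvalM v (oner_neq0 K) (oner_neq0 K); rewrite mulr1 => /esym/eqP.
by rewrite -subr_eq0 addrK => /eqP.
Qed.

Lemma dvalX (K : fieldType) (v : discreteValuation K) x n :
  x != 0 -> v (x ^+ n) = v x *+ n.
Proof.
move=> x0; elim: n => [|n IH]; first exact: dval1.
by rewrite exprS mulrS dvalM ?expf_neq0 ?IH.
Qed.

Lemma eisenstein_mod (p : nat) (k : fieldType) (W : comNzRingType)
    (res : {rmorphism W -> k}) (E : {poly W}) :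
  is_witt_ring p res -> eisenstein p E ->
  fps_map res (fps_of_poly E) = fps_var k ^+ (size E).-1.
Proof.
move=> W_witt [monE sE pE _]; apply/funext => n; rewrite fps_varXE /fps_map /fps_of_poly.
case: ltngtP => [lt_n|gt_n|->].
- by apply/(witt_res_ker W_witt)/pE.
- by rewrite nth_default ?rmorph0 // -(ltn_predK sE).
- by rewrite -/(lead_coef E) (monicP monE) rmorph1.
Qed.

(** The equation E(pi) = 0 reads pi^(deg E) = p y. The residue of y is nonzero because p^2 does not
    divide the constant term of E, so v(y) < 1, and comparing valuations gives deg E = e + v(y) <=
    e. *)
Lemma eisenstein_degree (p : nat) (k : fieldType) (W : comNzRingType)
    (resW : {rmorphism W -> k}) (K : fieldType) (v : discreteValuation K)
    (resK : {rmorphism valring v -> k}) (iota : {rmorphism W -> valring v})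
    (pi : valring v) (E : {poly W}) (e : nat) :
  is_witt_ring p resW -> is_residue_map resK -> p%:R != 0 :> K -> v p%:R = e%:Z ->
  (forall x, resK (iota x) = resW x) -> is_uniformizer pi ->
  eisenstein_poly_of p iota pi E -> ((size E).-1 <= e)%N.
Proof.
move=> W_witt [_ resK_ker] p0 ve iota_res [pi0 vpi] [[monE sE pE p2E] /eqP Epi].
have [d dE] : exists d, size E = d.+2 by case: (size E) sE => [|[|d]] // _; exists d.
rewrite dE /= in pE *.
have /choice[c cE] (i : 'I_d.+1) : exists c, E`_i = p%:R * c by exact: pE.
pose y : valring v := - \sum_(i < d.+1) iota (c i) * pi ^+ i.
have piE : pi ^+ d.+1 = p%:R * y.
  have size_le : (size (map_poly iota E) <= d.+2)%N by rewrite -dE size_poly.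
  move: Epi; rewrite (horner_coef_wide _ size_le) big_ord_recr /=.
  have -> : (map_poly iota E)`_d.+1 = 1.
    rewrite coef_map /=.
    have -> : E`_d.+1 = 1 by have := monicP monE; rewrite /lead_coef dE.
    by rewrite rmorph1.
  rewrite mul1r addrC => /eqP; rewrite addr_eq0 => /eqP ->.
  rewrite /y mulrN mulr_sumr; congr (- _); apply: eq_bigr => i _.
  by rewrite coef_map /= cE rmorphM rmorph_nat mulrA.
have rpi : resK pi = 0.
  by apply/resK_ker; rewrite unfold_in /dval_ge vpi lexx orbT.
have ry : resK y = - resW (c ord0).
  rewrite rmorphN rmorph_sum big_ord_recl big1 => [|i _].
    by rewrite addr0 rmorphM rmorph1 mulr1 /= iota_res.
  by rewrite rmorphM rmorphXn /= rpi exprS mul0r mulr0.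
have : resK y != 0.
  rewrite ry oppr_eq0; apply/eqP => /(witt_res_ker W_witt)[w wE].
  by apply: p2E; exists w; rewrite -[0%N]/(val (ord0 : 'I_d.+1)) cE wE mulrA.
move=> /eqP ryN0; have : valring_val y \notin dval_ge v 1 by apply/negP => /resK_ker.
rewrite unfold_in /dval_ge negb_or -ltNge => /andP[y0 vy].
have : v (valring_val pi ^+ d.+1) = e%:Z + v (valring_val y).
  rewrite -ve -dvalM //; congr (v _).
  by rewrite -(rmorphXn val) piE rmorphM rmorph_nat.
rewrite dvalX // vpi => dE'.
by rewrite -lez_nat -[_%:Z]natz dE' gerDl -ltzD1.
Qed.

Theorem theorem7p20
    (p : nat) (p_prime : prime p)
    (k : fieldType) (k_perfect : perfect_field p k)
    (W : comNzRingType) (resW : {rmorphism W -> k})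
    (W_witt : is_witt_ring p resW)
    (sigma : {rmorphism W -> W}) (sigma_frob : is_witt_frobenius p sigma)
    (K : fieldType) (K_char0 : [pchar K] =i pred0)
    (v : discreteValuation K) (v_complete : dval_complete v)
    (resK : {rmorphism valring v -> k}) (resK_residue : is_residue_map resK)
    (e : nat) (e_ramification : v p%:R = e%:Z)
    (iota : {rmorphism W -> valring v})
    (iota_res : forall x, resK (iota x) = resW x)
    (pi : valring v) (pi_unif : is_uniformizer pi)
    (E : {poly W}) (E_eisenstein : eisenstein_poly_of p iota pi E)
    (r : nat) (er_lt : (e * r < p - 1)%N) :
  forall M : phiMod p sigma E r, ModFI M <-> ModInf M.
Proof.
move=> M; split=> [[]//|MInf]; split=> //.
have p0 : p%:R != 0 :> K.
  by have := K_char0 p; rewrite !inE p_prime => /negbT.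
(* This bound turns er < p - 1 into the inequality for deg E in place of e. *)
have dE := eisenstein_degree W_witt resK_residue p0 e_ramification iota_res
  pi_unif E_eisenstein.
have Emod := eisenstein_mod W_witt E_eisenstein.1.
apply: (ModInf_torsion_sum p_prime k_perfect W_witt sigma_frob Emod) => //.
by rewrite (leq_ltn_trans _ er_lt) // leq_mul2r dE orbT.
Qed.
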